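(* Let $m\leqslant n$, let $A,H\in\mathbb{R}^{n\times n}$ and $Q\in\mathbb{R}^{m\times m}$ be symmetric positive definite matrices, and let $B\in\mathbb{R}^{m\times n}$ be rank-deficient. Let $\sigma_{\min}$ and $\sigma_{\max}$ be the smallest and the largest nonzero singular values of $B$, respectively. Then all the nonzero real eigenvalues of the matrix $\mathcal{K}^{-1}\mathcal{A}$ are located in the interval $[\ell,\,\upsilon]$, where $$\ell=\min\left\{\frac{\lambda_{\min}(A)}{\lambda_{\max}(H)+\lambda_{\min}(A)},\ \frac{\sigma_{\min}^2}{\lambda_{\max}(Q)\big(\lambda_{\max}(H)+\kappa(H)\lambda_{\max}(A)\big)+\sigma_{\min}^2}\right\}$$ and $$\upsilon=\frac{\lambda_{\min}(Q)\lambda_{\max}(A)+\sigma_{\max}^2}{\lambda_{\min}(Q)\big(\lambda_{\min}(H)+\lambda_{\max}(A)\big)+\sigma_{\max}^2}.$$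
   Context: ''$B$ is rank-deficient'' means $\mathrm{rank}(B)<m\leqslant n$. Define $$\mathcal{A}=\begin{pmatrix}A & B^T\\ -B & 0\end{pmatrix},\qquad \mathcal{K}=\begin{pmatrix}H&0\\0&Q\end{pmatrix}+\mathcal{A}=\begin{pmatrix}H+A & B^T\\ -B & Q\end{pmatrix},$$ where $\mathcal{K}$ is nonsingular. $\lambda_{\min}(\cdot)$ and $\lambda_{\max}(\cdot)$ denote the smallest and largest eigenvalues of a symmetric matrix. $\kappa(H)=\|H\|_2\|H^{-1}\|_2$ is the spectral condition number of $H$. *)

(* Defs.v *)
From HB Require Import structures.
From mathcomp Require Import all_boot all_order all_algebra.
From mathcomp Require Import classical_sets reals.

Set Implicit Arguments.
Unset Strict Implicit.
Unset Printing Implicit Defensive.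

Import Order.TTheory GRing.Theory Num.Theory.
Local Open Scope classical_set_scope.
Local Open Scope ring_scope.

Section Definitions.
Variable R : realType.

Definition sym_posdef n (M : 'M[R]_n) : Prop :=
  M \is symmetricmx /\ forall x : 'cV[R]_n, x != 0 -> 0 < (x^T *m M *m x) 0 0.

Definition least_element (E : set R) : set R := E `&` lbound E.
Definition greatest_element (E : set R) : set R := E `&` ubound E.

(* [eigenvalue] refers to row eigenvectors; a square matrix and its transpose
   have the same eigenvalues.  The default 0 of [xget] is never used for a
   symmetric matrix of positive size, whose spectrum is finite and nonempty. *)
Definition lambda_min n (M : 'M[R]_n) : R :=
  xget 0 (least_element [set a | eigenvalue M a]).
Definition lambda_max n (M : 'M[R]_n) : R :=
  xget 0 (greatest_element [set a | eigenvalue M a]).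

(* Square roots of the eigenvalues of B B^T.  When n < m, B B^T may contribute
   zeros that are not counted among the min(m, n) singular values of B; the
   nonzero ones are correct for all m and n. *)
Definition singular_value m n (B : 'M[R]_(m, n)) : set R :=
  [set s | 0 <= s /\ eigenvalue (B *m B^T) (s ^+ 2)].
Definition nonzero_singular_value m n (B : 'M[R]_(m, n)) : set R :=
  [set s | singular_value B s /\ s != 0].

(* The norm that MathComp-Analysis puts on matrices is the maximum norm. *)
Definition l2norm n (x : 'cV[R]_n) : R := Num.sqrt (\sum_i x i 0 ^+ 2).
Definition spectral_norm n (M : 'M[R]_n) : R :=
  sup [set l2norm (M *m x) | x in [set x : 'cV[R]_n | l2norm x = 1]].
Definition cond_number n (M : 'M[R]_n) : R :=
  spectral_norm M * spectral_norm (invmx M).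

Definition saddle_mx n m (A : 'M[R]_n) (B : 'M[R]_(m, n)) : 'M[R]_(n + m) :=
  block_mx A B^T (- B) 0.
Definition precond_mx n m (A H : 'M[R]_n) (Q : 'M[R]_m) (B : 'M[R]_(m, n)) :
    'M[R]_(n + m) :=
  block_mx H 0 0 Q + saddle_mx A B.

End Definitions.

(* Main.v *)
Require Import Defs.
From HB Require Import structures.
From mathcomp Require Import all_boot all_order all_algebra.
From mathcomp Require Import classical_sets reals.
From mathcomp Require Import complex ring.

Set Implicit Arguments.
Unset Strict Implicit.
Unset Printing Implicit Defensive.

Import Order.TTheory GRing.Theory Num.Theory.
Local Open Scope ring_scope.

(**
With [mu := lambda / (1 - lambda)], an eigenvector (x, y) satisfies
[A x + B^T y = mu H x] and [- B x = mu Q y].  Testing with [x] gives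
[x^T A x = mu (x^T H x + y^T Q y)], so [0 < mu <= lambda_max A / lambda_min H],
which is stronger than the upper bound.  For the lower bound one may assume
[mu * lambda_max H < lambda_min A], so that [M := A - mu H] is positive
definite.  Write [x = x1 + x2] with [x1] in [range B^T] and [x2] in [ker B].
Since [M x = - B^T y], [x2] is [M]-orthogonal to [x], hence
[mu y^T Q y = x1^T M x1 - x2^T M x2 <= lambda_max A |x1|^2], while
[sigma_min^2 |x1|^2 <= |B x1|^2 = mu^2 |Q y|^2 <= mu^2 lambda_max Q y^T Q y].
Thus [sigma_min^2 <= mu lambda_max Q lambda_max A], and [cond_number H >= 1].
*)

Section SymmetricMatrices.
Variable R : realType.

(** * Euclidean inner product and squared norm *)

Definition dot n (u v : 'cV[R]_n) : R := (u^T *m v) 0 0.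
Definition sqnorm n (u : 'cV[R]_n) : R := dot u u.

Lemma dotE n (u v : 'cV[R]_n) : dot u v = \sum_i u i 0 * v i 0.
Proof. by rewrite /dot mxE; apply: eq_bigr => i _; rewrite mxE. Qed.

Lemma dotC n (u v : 'cV[R]_n) : dot u v = dot v u.
Proof. by rewrite !dotE; apply: eq_bigr => i _; rewrite mulrC. Qed.

Lemma dotDl n (u v w : 'cV[R]_n) : dot (u + v) w = dot u w + dot v w.
Proof. by rewrite /dot linearD mulmxDl mxE. Qed.

Lemma dotDr n (u v w : 'cV[R]_n) : dot u (v + w) = dot u v + dot u w.
Proof. by rewrite /dot mulmxDr mxE. Qed.

Lemma dotZl n a (u v : 'cV[R]_n) : dot (a *: u) v = a * dot u v.
Proof. by rewrite /dot linearZ /= -scalemxAl mxE. Qed.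

Lemma dotZr n a (u v : 'cV[R]_n) : dot u (a *: v) = a * dot u v.
Proof. by rewrite /dot -scalemxAr mxE. Qed.

Lemma dot_mulmx m n (M : 'M[R]_(m, n)) (u : 'cV_m) (v : 'cV_n) :
  dot u (M *m v) = dot (M^T *m u) v.
Proof. by rewrite /dot trmx_mul trmxK mulmxA. Qed.

Lemma sqnorm_ge0 n (u : 'cV[R]_n) : 0 <= sqnorm u.
Proof. by rewrite /sqnorm dotE sumr_ge0 // => i _; rewrite -expr2 sqr_ge0. Qed.

Lemma sqnorm_eq0 n (u : 'cV[R]_n) : (sqnorm u == 0) = (u == 0).
Proof.
apply/idP/eqP => [|->]; last by rewrite /sqnorm /dot mulmx0 mxE.
rewrite /sqnorm dotE psumr_eq0 => [/allP u0|i _]; last by rewrite -expr2 sqr_ge0.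
apply/matrixP => i j; rewrite ord1 mxE; apply/eqP.
by have := u0 i (mem_index_enum _); rewrite mulf_eq0 orbb.
Qed.

Lemma sqnorm_gt0 n (u : 'cV[R]_n) : (0 < sqnorm u) = (u != 0).
Proof. by rewrite lt_def sqnorm_eq0 sqnorm_ge0 andbT. Qed.

Lemma symmetricmxP n (M : 'M[R]_n) : M \is symmetricmx -> M^T = M.
Proof. by move=> /is_hermitianmxP; rewrite expr0 scale1r map_mx_id. Qed.

(** * Unitary diagonalization of a real symmetric matrix *)

Local Notation C := R[i].
Local Notation cmx := (map_mx (real_complex R)).
Local Open Scope sesquilinear_scope.

(* The [w i] are the squared moduli of the coordinates of [x] in a complex
   unitary eigenbasis of [M], which avoids building a real one. *)
Lemma spectral_weights n (M : 'M[R]_n) : M^T = M ->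
  exists2 r : 'I_n -> R, forall i, eigenvalue M (r i) &
    forall x, exists2 w : 'I_n -> R, forall i, 0 <= w i &
      [/\ sqnorm x = \sum_i w i, dot x (M *m x) = \sum_i r i * w i &
          sqnorm (M *m x) = \sum_i r i ^+ 2 * w i].
Proof.
move=> Msym; pose MC : 'M[C]_n := cmx M.
have MCherm : MC \is hermsymmx.
  apply: realsym_hermsym.
    by apply/is_hermitianmxP; rewrite expr0 scale1r map_mx_id // map_trmx Msym.
  by apply/mxOverP => i j; rewrite mxE complex_real.
pose P := spectralmx MC; pose d := spectral_diag MC.
have Pu : P \is unitarymx := spectral_unitarymx MC.
have PV : invmx P = P ^t* by rewrite invmx_unitary.
have /orthomx_spectralP := hermitian_normalmx MCherm; rewrite -/P -/d => MCE.
pose r i := complex.Re (d 0 i).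
have rE i : (r i)%:C%C = d 0 i.
  by apply/RRe_real/mxOverP/hermitian_spectral_diag_real.
have xCE (x : 'cV[R]_n) : (cmx x)^T = (cmx x) ^t*.
  by apply/matrixP => i j; rewrite !mxE; apply/esym/CrealP; rewrite complex_real.
exists r => [i|x].
  rewrite -(eigenvalue_map (real_complex R)) /= rE; apply/eigenvalueP.
  (* Row [i] of [P] is a row eigenvector of [MC] because [P *m MC = diag_mx d *m P]. *)
  exists (row i P).
    rewrite -/MC [in LHS]MCE !mulmxA -row_mul mulmxV ?unitarymx_unit //.
    rewrite -!mulmxA mulmxA -row_mul mul1mx.
    apply/rowP => j; rewrite !mxE (bigD1 i) //= big1 => [|k ki].
      by rewrite !mxE eqxx mulr1n addr0.
    by rewrite !mxE eq_sym (negPf ki) mulr0n mul0r.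
  apply/eqP => /(congr1 (mulmx^~ (invmx P))).
  rewrite -row_mul mulmxV ?unitarymx_unit // mul0mx.
  by move=> /rowP/(_ i)/eqP; rewrite !mxE eqxx oner_eq0.
pose z := P *m cmx x; exists (fun i => complex.Re (z i 0 * (z i 0)^*)).
  by move=> i; rewrite -ler0c RRe_real ?mul_conjC_ge0 // ger0_real ?mul_conjC_ge0.
(* Taking [e] to be the all-ones row, [d] and the entrywise square of [d] gives the three
   identities. *)
have formE e :
    ((cmx x)^T *m (invmx P *m diag_mx e *m P) *m cmx x) 0 0 =
    \sum_i e 0 i * (z i 0 * (z i 0)^*).
  rewrite xCE PV !mulmxA -mulmxA -!map_mxM -trmx_mul -mulmxA -/z.
  rewrite mxE; apply: eq_bigr => i _; rewrite mul_diag_mx !mxE mulrCA.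
  by congr (_ * _); rewrite mulrC.
have wE i : (complex.Re (z i 0 * (z i 0)^*))%:C%C = z i 0 * (z i 0)^*.
  by rewrite RRe_real // ger0_real ?mul_conjC_ge0.
have C00 (X : 'M[R]_(1, 1)) : (X 0 0)%:C%C = cmx X 0 0 by rewrite mxE.
split; apply: complexI; rewrite rmorph_sum /=.
- have := formE (const_mx 1); rewrite diag_const_mx mulmx1 mulVmx ?unitarymx_unit //.
  rewrite mulmx1 /sqnorm /dot C00 // map_mxM -map_trmx => ->.
  by apply: eq_bigr => i _; rewrite mxE mul1r wE.
- rewrite /dot C00 // mulmxA !map_mxM /= -/MC MCE -map_trmx formE.
  by apply: eq_bigr => i _; rewrite rmorphM /= wE rE.
- rewrite /sqnorm /dot C00 // trmx_mul Msym !mulmxA -[_ *m M *m M]mulmxA.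
  rewrite !map_mxM /= -/MC.
  have -> : MC *m MC = invmx P *m diag_mx (\row_i (d 0 i ^+ 2)) *m P.
    rewrite {1}MCE [X in _ *m X]MCE !mulmxA mulmxK ?unitarymx_unit //.
    rewrite -[_ *m diag_mx d *m diag_mx d]mulmxA mulmx_diag.
    suff <- : \row_i (d 0 i ^+ 2) = \row_j (d 0 j * d 0 j) by [].
    by apply/rowP => i; rewrite !mxE expr2.
  rewrite -map_trmx formE.
  by apply: eq_bigr => i _; rewrite rmorphM rmorphXn /= wE rE !mxE.
Qed.

(** * Rayleigh quotient bounds by extreme eigenvalues *)

Lemma sym_eigenvector n (M : 'M[R]_n) a : M^T = M -> eigenvalue M a ->
  exists2 x : 'cV[R]_n, M *m x = a *: x & x != 0.
Proof.
move=> Msym /eigenvalueP [v vM v0]; exists v^T.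
  by rewrite -[X in X *m _]Msym -trmx_mul vM linearZ.
by rewrite trmx_eq0.
Qed.

Lemma eigenvalue_ge n (M : 'M[R]_n) a c : M^T = M ->
  (forall x, c * sqnorm x <= dot x (M *m x)) -> eigenvalue M a -> c <= a.
Proof.
move=> Msym cM /(sym_eigenvector Msym) [x Mx]; rewrite -sqnorm_gt0 => x0.
by have := cM x; rewrite Mx dotZr ler_pM2r.
Qed.

Lemma eigenvalue_le n (M : 'M[R]_n) a c : M^T = M ->
  (forall x, dot x (M *m x) <= c * sqnorm x) -> eigenvalue M a -> a <= c.
Proof.
move=> Msym cM /(sym_eigenvector Msym) [x Mx]; rewrite -sqnorm_gt0 => x0.
by have := cM x; rewrite Mx dotZr ler_pM2r.
Qed.

(** Weights are nonnegative and sum to [sqnorm x], so the least [r i] bounds the quadratic form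
    below. It therefore bounds every eigenvalue below and is itself one, so [xget] never falls back
    to its default. *)
Lemma lambda_minP n (M : 'M[R]_n) : (0 < n)%N -> M^T = M ->
  eigenvalue M (lambda_min M) /\
  forall x, lambda_min M * sqnorm x <= dot x (M *m x).
Proof.
move=> n0 Msym; have [r rM rW] := spectral_weights Msym.
pose i0 := [arg min_(i < Ordinal n0) r i]%O.
have r0 i : r i0 <= r i by rewrite /i0; case: arg_minP => // j _ /(_ i isT).
have r0M x : r i0 * sqnorm x <= dot x (M *m x).
  have [w w0 [-> -> _]] := rW x.
  by rewrite mulr_sumr; apply: ler_sum => i _; rewrite ler_wpM2r.
have : least_element [set a | eigenvalue M a]%classic (lambda_min M).
  apply: (@xgetI _ _ _ (r i0)); split; first exact: rM.
  by move=> a; apply: eigenvalue_ge.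
case=> lM lle; split=> // x; apply: le_trans (r0M x).
by rewrite ler_wpM2r ?sqnorm_ge0 // lle //; apply: rM.
Qed.

Lemma lambda_max_spectral n (M : 'M[R]_n) : (0 < n)%N -> M^T = M ->
  greatest_element [set a | eigenvalue M a]%classic (lambda_max M).
Proof.
move=> n0 Msym; have [r rM rW] := spectral_weights Msym.
pose i0 := [arg max_(i > Ordinal n0) r i]%O.
have r0 i : r i <= r i0 by rewrite /i0; case: arg_maxP => // j _ /(_ i isT).
apply: (@xgetI _ _ _ (r i0)); split; first exact: rM.
move=> a; apply: eigenvalue_le => // x.
have [w w0 [-> -> _]] := rW x.
by rewrite mulr_sumr; apply: ler_sum => i _; rewrite ler_wpM2r.
Qed.

Lemma lambda_maxP n (M : 'M[R]_n) x : (0 < n)%N -> M^T = M ->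
  dot x (M *m x) <= lambda_max M * sqnorm x.
Proof.
move=> n0 Msym; have [_ lM] := lambda_max_spectral n0 Msym.
have [r rM /(_ x)[w w0 [-> -> _]]] := spectral_weights Msym.
rewrite mulr_sumr; apply: ler_sum => i _; rewrite ler_wpM2r //.
by apply: lM; apply: rM.
Qed.

(** * Positive definite matrices *)

Lemma sym_posdef_tr n (M : 'M[R]_n) : sym_posdef M -> M^T = M.
Proof. by case=> /symmetricmxP. Qed.

Lemma sym_posdef_dot n (M : 'M[R]_n) x : sym_posdef M -> x != 0 ->
  0 < dot x (M *m x).
Proof. by case=> _ Mpd x0; rewrite /dot mulmxA; apply: Mpd. Qed.

Lemma sym_posdef_dot_ge0 n (M : 'M[R]_n) x : sym_posdef M ->
  0 <= dot x (M *m x).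
Proof.
move=> Mpd; have [->|x0] := eqVneq x 0; first by rewrite mulmx0 sqnorm_ge0.
exact/ltW/sym_posdef_dot.
Qed.

Lemma sym_posdef_eigenvalue_gt0 n (M : 'M[R]_n) a : sym_posdef M ->
  eigenvalue M a -> 0 < a.
Proof.
move=> Mpd /(sym_eigenvector (sym_posdef_tr Mpd)) [x Mx x0].
have := sym_posdef_dot Mpd x0; rewrite Mx dotZr pmulr_lgt0 //.
by rewrite sqnorm_gt0.
Qed.

Lemma lambda_min_gt0 n (M : 'M[R]_n) : (0 < n)%N -> sym_posdef M ->
  0 < lambda_min M.
Proof.
move=> n0 Mpd; apply: (sym_posdef_eigenvalue_gt0 Mpd).
exact: (lambda_minP n0 (sym_posdef_tr Mpd)).1.
Qed.

Lemma lambda_max_gt0 n (M : 'M[R]_n) : (0 < n)%N -> sym_posdef M ->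
  0 < lambda_max M.
Proof.
move=> n0 Mpd; apply: (sym_posdef_eigenvalue_gt0 Mpd).
exact: (lambda_max_spectral n0 (sym_posdef_tr Mpd)).1.
Qed.

(** Weight by weight this is [r i ^+ 2 <= lambda_max M * r i], valid since the eigenvalues are
    positive. *)
Lemma sqnorm_mulmx_le n (M : 'M[R]_n) x : (0 < n)%N -> sym_posdef M ->
  sqnorm (M *m x) <= lambda_max M * dot x (M *m x).
Proof.
move=> n0 Mpd; have Msym := sym_posdef_tr Mpd.
have [_ lM] := lambda_max_spectral n0 Msym.
have [r rM /(_ x)[w w0 [_ -> ->]]] := spectral_weights Msym.
rewrite mulr_sumr; apply: ler_sum => i _.
rewrite mulrA ler_wpM2r // expr2 ler_wpM2r //; last by apply: lM; apply: rM.
exact/ltW/(sym_posdef_eigenvalue_gt0 Mpd).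
Qed.

(** * Singular values, spectral norm and condition number *)

(** The restriction to vectors [B^T *m u] removes the kernel of [B]. With [G = B *m B^T], the left
    side is [s ^+ 2] times the form of [G] at [u], and the right side is [sqnorm (G *m u)]. *)
Lemma nonzero_singular_value_le m n (B : 'M[R]_(m, n)) s u :
  least_element (nonzero_singular_value B) s ->
  s ^+ 2 * sqnorm (B^T *m u) <= sqnorm (B *m (B^T *m u)).
Proof.
move=> [[[s0 _] _] s_least].
have Gsym : (B *m B^T)^T = B *m B^T by rewrite trmx_mul trmxK.
have [r rG /(_ u)[w w0 [_ uGu Gu]]] := spectral_weights Gsym.
have -> : sqnorm (B^T *m u) = dot u ((B *m B^T) *m u).
  by rewrite /sqnorm dot_mulmx trmxK mulmxA dotC.
rewrite mulmxA uGu Gu mulr_sumr; apply: ler_sum => i _.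
(* Zero eigenvalues contribute nothing to either side; for the others [Num.sqrt (r i)] is a nonzero
   singular value. *)
have [->|ri0] := eqVneq (r i) 0; first by rewrite expr0n !mul0r mulr0.
have ri_ge0 : 0 <= r i.
  apply: (eigenvalue_ge Gsym) (rG i) => x.
  by rewrite mul0r -mulmxA dot_mulmx sqnorm_ge0.
have : s <= Num.sqrt (r i).
  apply: s_least; split; first split; rewrite ?sqrtr_ge0 ?sqr_sqrtr //=.
  by rewrite sqrtr_eq0 -ltNge lt_def ri0.
rewrite -[_ <= _](@ler_pXn2r _ 2) ?nnegrE ?sqrtr_ge0 // sqr_sqrtr // => s_r.
by rewrite mulrA ler_wpM2r // expr2 ler_wpM2r.
Qed.

Lemma sqnormZ n a (x : 'cV[R]_n) : sqnorm (a *: x) = a ^+ 2 * sqnorm x.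
Proof. by rewrite /sqnorm dotZl dotZr mulrA expr2. Qed.

Lemma l2normE n (x : 'cV[R]_n) : l2norm x = Num.sqrt (sqnorm x).
Proof.
by rewrite /l2norm /sqnorm dotE; congr Num.sqrt; apply: eq_bigr => i _.
Qed.

Lemma spectral_norm_ge n (M : 'M[R]_n) x : (0 < n)%N -> l2norm x = 1 ->
  l2norm (M *m x) <= spectral_norm M.
Proof.
move=> n0 x1; apply: ub_le_sup; last by exists x.
(* A supremum dominates the elements of its set only if the set is bounded; this is an explicit
   bound. *)
exists (Num.sqrt (lambda_max (M^T *m M))) => _ [y y1 <-].
have yy1 : sqnorm y = 1.
  by rewrite -[LHS]sqr_sqrtr ?sqnorm_ge0 // -l2normE y1 expr1n.
rewrite l2normE ler_wsqrtr // /sqnorm dot_mulmx mulmxA dotC.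
by rewrite -[leRHS]mulr1 -yy1 lambda_maxP // trmx_mul trmxK.
Qed.

(** On a unit eigenvector for [lambda_min M], the norms of [M] and [invmx M] are at least
    [lambda_min M] and its inverse, whose product is 1. *)
Lemma cond_number_ge1 n (M : 'M[R]_n) : (0 < n)%N -> sym_posdef M ->
  1 <= cond_number M.
Proof.
move=> n0 Mpd; have Msym := sym_posdef_tr Mpd.
have l0 := lambda_min_gt0 n0 Mpd.
have [lM _] := lambda_minP n0 Msym.
have [x Mx x0] := sym_eigenvector Msym lM.
have Munit : M \in unitmx.
  rewrite -row_free_unit -kermx_eq0; apply/negPn/negP => ker0.
  have /(sym_posdef_eigenvalue_gt0 Mpd) : eigenvalue M 0.
    by rewrite /eigenvalue /eigenspace raddf0 subr0.
  by rewrite ltxx.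
pose e := (Num.sqrt (sqnorm x))^-1 *: x.
have e1 : l2norm e = 1.
  rewrite l2normE sqnormZ exprVn sqr_sqrtr ?sqnorm_ge0 // mulVf ?sqrtr1 //.
  by rewrite sqnorm_eq0.
have Me : M *m e = lambda_min M *: e by rewrite -scalemxAr Mx !scalerA mulrC.
have MVe : invmx M *m e = (lambda_min M)^-1 *: e.
  apply: (canLR (mulKmx Munit)).
  by rewrite -scalemxAr Me scalerA mulVf ?scale1r // gt_eqF.
have le_norm a (N : 'M[R]_n) : 0 < a -> N *m e = a *: e -> a <= spectral_norm N.
  move=> a0 Ne; have := spectral_norm_ge N n0 e1; rewrite Ne.
  rewrite l2normE sqnormZ sqrtrM ?sqr_ge0 // sqrtr_sqr -l2normE e1 mulr1.
  by rewrite gtr0_norm.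
rewrite -(mulfV (lt0r_neq0 l0)) /cond_number.
by apply: ler_pM; rewrite ?invr_ge0 ?(ltW l0) //; apply: le_norm; rewrite ?invr_gt0.
Qed.

(** The normal equation [B *m B^T *m u = B *m x] is solvable even if [B *m B^T] is singular, since
    [B *m B^T] and [B^T] have the same row space. *)
Lemma range_ker_decomp m n (B : 'M[R]_(m, n)) (x : 'cV[R]_n) :
  exists u, B *m (x - B^T *m u) = 0.
Proof.
(* If [v = u *m B] and [v *m B^T = 0], then [v *m v^T = 0]. Hence multiplying [B] by [B^T] loses no
   rank. *)
have cap0 : (B :&: kermx B^T = 0)%MS.
  apply/eqP; rewrite -submx0; apply/rV_subP => v.
  rewrite sub_capmx => /andP[/submxP[u vE] /sub_kermxP vB].
  suff /eqP : v^T = 0 by rewrite trmx_eq0 => /eqP ->; rewrite sub0mx.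
  apply/eqP; rewrite -sqnorm_eq0 /sqnorm /dot trmxK {2}vE trmx_mul mulmxA vB.
  by rewrite mul0mx mxE.
have rkG : \rank (B *m B^T) = \rank B.
  by have := mxrank_mul_ker B B^T; rewrite cap0 mxrank0 addn0.
have : (x^T *m B^T <= B *m B^T)%MS.
  apply: submx_trans (submxMl _ _) _.
  (* An inclusion of row spaces of equal rank is an equality. *)
  have /mxrank_leqif_sup : (B *m B^T <= B^T)%MS by apply: submxMl.
  by move=> /leqifP; rewrite rkG mxrank_tr; case: ifP => // _; rewrite ltnn.
move=> /submxP[v xBv]; exists v^T.
apply: trmx_inj; rewrite mulmxBr linearB /= trmx0; apply/eqP; rewrite subr_eq0; apply/eqP.
by rewrite !trmx_mul !trmxK xBv mulmxA.
Qed.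

(** * From eigenvectors of the preconditioned matrix to a pencil *)

Lemma eigenvalue_trmx n (M : 'M[R]_n) a : eigenvalue M^T a = eigenvalue M a.
Proof.
rewrite /eigenvalue /eigenspace !kermx_eq0 !row_free_unit -unitmx_tr.
by rewrite linearB /= trmxK tr_scalar_mx.
Qed.

(** With [D] the block diagonal of [H] and [Q], and [K = D + S], the equation [S w = lam K w]
    becomes [(1 - lam) S w = lam D w]; divide by [1 - lam]. *)
Lemma saddle_eigenvector n m (A H : 'M[R]_n) (Q : 'M[R]_m) (B : 'M[R]_(m, n))
    (lam : R) :
  sym_posdef H -> sym_posdef Q ->
  precond_mx A H Q B \in unitmx ->
  eigenvalue (invmx (precond_mx A H Q B) *m saddle_mx A B) lam -> lam != 0 ->
  exists (x : 'cV[R]_n) (y : 'cV[R]_m) mu, [/\ lam * (1 + mu) = mu, mu != 0, x != 0 \/ y != 0,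
    A *m x + B^T *m y = mu *: (H *m x) & - (B *m x) = mu *: (Q *m y)].
Proof.
move=> Hpd Qpd; set K := precond_mx _ _ _ _; set S := saddle_mx _ _.
move=> Ku lamE lam0.
have {lamE} [w wE w0] : exists2 w : 'cV[R]_(n + m), S *m w = lam *: (K *m w) & w != 0.
  have : eigenvalue (invmx K *m S)^T lam.
    by rewrite eigenvalue_trmx.
  move=> /eigenvalueP [v vE v0]; exists v^T; last by rewrite trmx_eq0.
  move: vE => /(congr1 trmx); rewrite trmx_mul trmxK linearZ /= => vE.
  by rewrite scalemxAr -vE !mulmxA mulmxV // mul1mx.
have [x [y wxy]] : exists (x : 'cV_n) (y : 'cV_m), w = col_mx x y.
  by exists (usubmx w), (dsubmx w); rewrite vsubmxK.
have xy0 : x != 0 \/ y != 0.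
  have [x0|] := eqVneq x 0; last by left.
  right; apply: contraNneq w0 => y0.
  by rewrite wxy x0 y0 col_mx0.
move: wE; rewrite wxy /K /precond_mx -/S mulmxDl scalerDr.
rewrite /S /saddle_mx !mul_block_col !mul0mx !addr0 !add0r.
rewrite !scale_col_mx add_col_mx mulNmx => /eq_col_mx [E1 E2].
(* If [lam = 1], then [H *m x = 0] and [Q *m y = 0], so definiteness forces [x] and [y] to
   vanish. *)
have lam1 : 1 - lam != 0.
  rewrite subr_eq0; apply/eqP => l1; move: E1 E2; rewrite -l1 !scale1r.
  move=> /esym/eqP; rewrite addrC -subr_eq0 addrAC subrr add0r => /eqP Hx.
  move=> /esym/eqP; rewrite addrC -subr_eq0 addrAC subrr add0r => /eqP Qy.
  case: xy0 => /[dup] z0.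
    by move/(sym_posdef_dot Hpd); rewrite Hx /dot mulmx0 mxE ltxx.
  by move/(sym_posdef_dot Qpd); rewrite Qy /dot mulmx0 mxE ltxx.
exists x, y, (lam / (1 - lam)); split => //.
- by field.
- by rewrite mulf_neq0 // invr_eq0.
- apply: (scalerI lam1); rewrite scalerA mulrCA divff // mulr1.
  by rewrite scalerBl scale1r {1}E1 addrK.
- apply: (scalerI lam1); rewrite scalerA mulrCA divff // mulr1.
  by rewrite scalerBl scale1r {1}E2 addrK.
Qed.

(** * Bounds on [mu] *)

Section QuadraticPencil.
Variables (n m : nat) (A H : 'M[R]_n) (Q : 'M[R]_m) (B : 'M[R]_(m, n)).
Hypotheses (n_gt0 : (0 < n)%N) (m_gt0 : (0 < m)%N).
Hypotheses (A_spd : sym_posdef A) (H_spd : sym_posdef H) (Q_spd : sym_posdef Q).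
Variables (mu : R) (x : 'cV[R]_n) (y : 'cV[R]_m).
Hypothesis mu_neq0 : mu != 0.
Hypothesis xy_neq0 : x != 0 \/ y != 0.
Hypothesis eqx : A *m x + B^T *m y = mu *: (H *m x).
Hypothesis eqy : - (B *m x) = mu *: (Q *m y).

(** If [x = 0], the second equation gives [Q *m y = 0], hence [y = 0]. *)
Lemma pencil_x_neq0 : x != 0.
Proof.
case: xy_neq0 => // y0; apply: contraTneq (sym_posdef_dot Q_spd y0) => x0.
move: eqy; rewrite x0 mulmx0 oppr0 => /esym/eqP.
rewrite scaler_eq0 (negPf mu_neq0) => /eqP ->.
by rewrite /dot mulmx0 mxE ltxx.
Qed.

Lemma dotBy : dot (B *m x) y = - (mu * dot y (Q *m y)).
Proof.
have -> : B *m x = - (mu *: (Q *m y)) by rewrite -eqy opprK.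
by rewrite dotC -scaleN1r dotZr dotZr mulN1r.
Qed.

Lemma pencil_energy :
  dot x (A *m x) = mu * (dot x (H *m x) + dot y (Q *m y)).
Proof.
have := congr1 (dot x) eqx.
by rewrite dotDr dotZr (dot_mulmx B^T) trmxK dotBy mulrDr => /eqP; rewrite subr_eq => /eqP.
Qed.

Lemma pencil_gt0 : 0 < mu.
Proof.
have Ax := sym_posdef_dot A_spd pencil_x_neq0.
have Hx := sym_posdef_dot H_spd pencil_x_neq0.
have Qy := sym_posdef_dot_ge0 y Q_spd.
by move: Ax; rewrite pencil_energy pmulr_lgt0 // ltr_wpDr.
Qed.

Lemma pencil_le : mu * lambda_min H <= lambda_max A.
Proof.
have x2 : 0 < sqnorm x by rewrite sqnorm_gt0 pencil_x_neq0.
rewrite -(ler_pM2r x2); apply: le_trans (lambda_maxP _ n_gt0 (sym_posdef_tr A_spd)).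
rewrite pencil_energy -mulrA ler_pM2l ?pencil_gt0 //.
have [_ /(_ x) Hx] := lambda_minP n_gt0 (sym_posdef_tr H_spd).
by rewrite (le_trans Hx) // lerDl sym_posdef_dot_ge0.
Qed.

(** The two alternatives correspond to the two entries of the minimum in the lower bound. *)
Lemma pencil_ge s : least_element (nonzero_singular_value B) s ->
  lambda_min A <= mu * lambda_max H \/
  s ^+ 2 <= mu * (lambda_max Q * lambda_max A).
Proof.
move=> s_least; have mu0 := pencil_gt0.
have [|muH] := lerP (lambda_min A) (mu * lambda_max H); [by left | right].
pose M := A - mu *: H.
have Msym : M^T = M by rewrite linearB linearZ /= !sym_posdef_tr.
have dotM z : dot z (M *m z) = dot z (A *m z) - mu * dot z (H *m z).
  by rewrite mulmxBl -scalemxAl -scaleN1r dotDr !dotZr mulN1r.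
have Mge z : (lambda_min A - mu * lambda_max H) * sqnorm z <= dot z (M *m z).
  rewrite dotM mulrBl lerB //.
    by have [_ ->] := lambda_minP n_gt0 (sym_posdef_tr A_spd).
  by rewrite -mulrA ler_pM2l // lambda_maxP // sym_posdef_tr.
have Mge0 z : 0 <= dot z (M *m z).
  by apply: le_trans (Mge z); rewrite mulr_ge0 ?sqnorm_ge0 // subr_ge0 ltW.
have Mx : M *m x = - (B^T *m y).
  by rewrite mulmxBl -scalemxAl -eqx opprD addNKr.
have [u Bu] := range_ker_decomp B x.
pose x1 := B^T *m u; pose x2 := x - x1.
have xE : x = x1 + x2 by rewrite addrC subrK.
have Bx1 : B *m x1 = B *m x.
  by apply/esym/eqP; rewrite -subr_eq0 -mulmxBr Bu.
have dotMx z : dot z (M *m x) = - dot (B *m z) y.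
  by rewrite Mx -scaleN1r dotZr dot_mulmx trmxK mulN1r.
have x2Mx : dot x2 (M *m x) = 0.
  by rewrite dotMx Bu /dot trmx0 mul0mx mxE oppr0.
have x1Mx : dot x1 (M *m x) = mu * dot y (Q *m y).
  by rewrite dotMx Bx1 dotBy opprK.
(* Expanding [x = x1 + x2] in [x1Mx] and [x2Mx], symmetry of [M] lets the cross term be eliminated.
   The nonpositive terms from [x2] and from [H] are then dropped. *)
have Qy_le : mu * dot y (Q *m y) <= lambda_max A * sqnorm x1.
  have -> : mu * dot y (Q *m y) = dot x1 (M *m x1) - dot x2 (M *m x2).
    move: x1Mx x2Mx; rewrite {1 2}xE mulmxDr !dotDr.
    have -> : dot x2 (M *m x1) = dot x1 (M *m x2).
      by rewrite dot_mulmx Msym dotC.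
    by move=> <- /eqP; rewrite addr_eq0 => /eqP ->.
  apply: le_trans (lambda_maxP _ n_gt0 (sym_posdef_tr A_spd)).
  have H0 := sym_posdef_dot_ge0 x1 H_spd.
  by rewrite dotM -addrA gerDl -opprD oppr_le0 addr_ge0 // mulr_ge0 // ltW.
(* If [x1 = 0], then [Qy_le] makes [mu * dot y (Q *m y)] nonpositive, but it equals
   [dot x (M *m x)], which is positive. *)
have x1_gt0 : 0 < sqnorm x1.
  rewrite lt_def sqnorm_ge0 andbT; apply/negP => /eqP x10.
  have y0 : dot y (Q *m y) <= 0.
    by move: Qy_le; rewrite x10 mulr0 pmulr_rle0.
  have : 0 < dot x (M *m x).
    apply: lt_le_trans (Mge x).
    by rewrite mulr_gt0 ?subr_gt0 // sqnorm_gt0 pencil_x_neq0.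
  by rewrite {1}xE dotDl x1Mx x2Mx addr0 pmulr_rgt0 // ltNge y0.
rewrite -(ler_pM2r x1_gt0).
apply: (le_trans (nonzero_singular_value_le u s_least)).
rewrite -/x1 Bx1.
have -> : sqnorm (B *m x) = mu ^+ 2 * sqnorm (Q *m y).
  by rewrite -sqnormZ -eqy -scaleN1r sqnormZ sqrrN expr1n mul1r.
have Q0 := ltW (lambda_max_gt0 m_gt0 Q_spd).
(* One factor [mu] is kept with [dot y (Q *m y)] so that [Qy_le] applies. *)
apply: (@le_trans _ _ (mu * lambda_max Q * (mu * dot y (Q *m y)))).
  rewrite mulrACA -expr2 ler_wpM2l ?sqr_ge0 //.
  exact: sqnorm_mulmx_le.
by rewrite [mu * (lambda_max Q * _)]mulrA -[leRHS]mulrA ler_wpM2l // mulr_ge0 // ltW.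
Qed.

End QuadraticPencil.

End SymmetricMatrices.

(** * Transfer of the bounds from [mu] to [lambda] *)

Theorem theorem5 (R : realType) (m n : nat) (le_mn : (m <= n)%N)
    (A H : 'M[R]_n) (Q : 'M[R]_m) (B : 'M[R]_(m, n))
    (A_spd : sym_posdef A) (H_spd : sym_posdef H) (Q_spd : sym_posdef Q)
    (B_rank_deficient : (\rank B < m)%N)
    (K_nonsingular : precond_mx A H Q B \in unitmx)
    (sigma_min sigma_max : R)
    (sigma_minP : least_element (nonzero_singular_value B) sigma_min)
    (sigma_maxP : greatest_element (nonzero_singular_value B) sigma_max)
    (lambda : R)
    (lambda_eig : eigenvalue (invmx (precond_mx A H Q B) *m saddle_mx A B) lambda)
    (lambda_neq0 : lambda != 0) :
  lambda \in `[ Num.min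
                  (lambda_min A / (lambda_max H + lambda_min A))
                  (sigma_min ^+ 2
                   / (lambda_max Q * (lambda_max H + cond_number H * lambda_max A)
                      + sigma_min ^+ 2)),
                (lambda_min Q * lambda_max A + sigma_max ^+ 2)
                / (lambda_min Q * (lambda_min H + lambda_max A)
                   + sigma_max ^+ 2) ].
Proof.
(* A rank below [m] forces [m] to be positive, so the extreme eigenvalues of [Q], and then those of
   [A] and [H], exist. *)
have m_gt0 : (0 < m)%N by apply: leq_ltn_trans B_rank_deficient.
have n_gt0 : (0 < n)%N by apply: leq_trans le_mn.
have [x [y [mu [lamE mu0 xy0 eqx eqy]]]] :=
  saddle_eigenvector H_spd Q_spd K_nonsingular lambda_eig lambda_neq0.
have mu_gt0 := pencil_gt0 A_spd H_spd Q_spd mu0 xy0 eqx eqy.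
have mu_le := pencil_le n_gt0 A_spd H_spd Q_spd mu0 xy0 eqx eqy.
have mu_ge := pencil_ge n_gt0 m_gt0 A_spd H_spd Q_spd mu0 xy0 eqx eqy sigma_minP.
have mu1 : 0 < 1 + mu by rewrite addr_gt0.
have -> : lambda = mu / (1 + mu) by rewrite -{1}lamE mulfK // gt_eqF.
(* [a / (b + a)] is the value at [a / b] of the increasing map taking [t] to [t / (1 + t)]. *)
have le_frac (a b : R) : 0 <= a -> 0 < b ->
    (a / (b + a) <= mu / (1 + mu)) = (a <= mu * b).
  move=> a0 b0; have ba : 0 < b + a by rewrite ltr_wpDr.
  by rewrite ler_pdivrMr // mulrAC ler_pdivlMr // mulrDr mulr1 [a + _]addrC mulrDr
    [a * mu]mulrC addrC lerD2r.
have a0 := lambda_min_gt0 n_gt0 A_spd.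
have a1 := lambda_max_gt0 n_gt0 A_spd.
have h0 := lambda_min_gt0 n_gt0 H_spd.
have h1 := lambda_max_gt0 n_gt0 H_spd.
have q0 := lambda_min_gt0 m_gt0 Q_spd.
have q1 := lambda_max_gt0 m_gt0 Q_spd.
have k1 := cond_number_ge1 n_gt0 H_spd.
have k_gt0 : 0 < cond_number H by apply: lt_le_trans k1.
rewrite in_itv /=; apply/andP; split.
  rewrite ge_min; case: mu_ge => [mu_ge|mu_ge]; apply/orP; [left|right].
    by rewrite le_frac // ltW.
  (* The bound on [mu] is weakened by enlarging [lambda_max A] to this sum, using
     [cond_number H >= 1]. *)
  have D0 : 0 < lambda_max H + cond_number H * lambda_max A.
    by rewrite addr_gt0 // mulr_gt0.
  rewrite le_frac ?sqr_ge0 ?mulr_gt0 //; apply: le_trans mu_ge _.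
  rewrite ler_pM2l // ler_pM2l // ler_wpDl ?(ltW h1) //.
  by rewrite ler_peMl // ltW.
have s2 := sqr_ge0 sigma_max.
(* The denominator is now [E + D], with [D] the numerator and [E = lambda_min Q * lambda_min H]. The
   claim reduces to [mu * E <= D], which is [mu_le] times [lambda_min Q], with [sigma_max ^+ 2] as
   slack. *)
rewrite mulrDr -addrA.
have D0 : 0 < lambda_min Q * lambda_max A + sigma_max ^+ 2.
  by rewrite ltr_wpDr // mulr_gt0.
have E0 : 0 < lambda_min Q * lambda_min H by rewrite mulr_gt0.
have ED0 := addr_gt0 E0 D0.
rewrite ler_pdivrMr // mulrAC ler_pdivlMr // mulrDr [leRHS]mulrDr mulr1.
rewrite [leRHS]addrC [mu * (_ + _)]mulrC addrC.
by rewrite lerD2r mulrCA ler_wpDr // ler_pM2l.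
Qed.
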